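(* Let $\Lambda$ be an infinite set (countable or uncountable) and let $\Gamma$ be a subshift of $\Lambda^\omega$. If $\Gamma$ is a subshift of finite type, then $\Gamma$ is internally chain transitive (for $\sigma$).
   Context: Let $\omega=\{0,1,2,\dots\}$. $\Lambda^\omega$ is the set of infinite sequences $x=x_0x_1x_2\cdots$ over $\Lambda$, with the product topology where $\Lambda$ is discrete, metrized by $d(x,y)=\inf\{2^{-n}: x_i=y_i \text{ for all } i<n\}$; the shift map is $\sigma(x_0x_1x_2\cdots)=x_1x_2\cdots$. A subshift of $\Lambda^\omega$ is a closed set $\Gamma\subseteq\Lambda^\omega$ with $\sigma(\Gamma)=\Gamma$. A word is a finite sequence over $\Lambda$ of length at least $1$; it is allowed for $\Gamma$ if it occurs as a block of consecutive symbols (subword) of some $x\in\Gamma$, and forbidden otherwise. A basis for the forbidden words of $\Gamma$ is a set $\mathcal F$ of forbidden words such that every forbidden word contains some element of $\mathcal F$ as a subword. $\Gamma$ is a subshift of finite type (SFT) if it has a finite basis for its forbidden words. For $\delta>0$, a $\delta$-chain from $a$ to $b$ is a finite sequence $x_0,x_1,\dots,x_n$ with $n\ge1$, $x_0=a$, $x_n=b$ and $d(\sigma(x_i),x_{i+1})<\delta$ for all $i<n$. A set $A$ is internally chain transitive (ICT) if for all $a,b\in A$ and all $\delta>0$ there is a $\delta$-chain from $a$ to $b$ consisting of elements of $A$. *)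

(* Defs.v *)
From mathcomp Require Import all_boot all_order all_algebra.
From mathcomp Require Import all_classical all_reals topology.

Set Implicit Arguments.
Unset Strict Implicit.
Unset Printing Implicit Defensive.

Import Order.TTheory GRing.Theory Num.Theory.
Local Open Scope classical_set_scope.
Local Open Scope ring_scope.

Section Shift.
Variable Lam : choiceType.

Definition shift_space : topologicalType :=
  prod_topology (fun _ : nat => discrete_topology Lam).

Implicit Types (x y : shift_space) (G A : set shift_space) (w : seq Lam).

Definition shift x : shift_space := fun i => x i.+1.

Definition is_subshift G : Prop := closed G /\ shift @` G = G.

Definition is_word w : Prop := (0 < size w)%N.

Definition occurs_in w x : Prop :=
  exists i : nat, w = mkseq (fun k => x (i + k)%N : Lam) (size w).

Definition allowed G w : Prop :=
  is_word w /\ exists2 x, G x & occurs_in w x.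

Definition forbidden G w : Prop := is_word w /\ ~ allowed G w.

Definition is_basis G (F : set (seq Lam)) : Prop :=
  F `<=` forbidden G /\
  forall w, forbidden G w -> exists2 u, F u & infix u w.

Definition is_SFT G : Prop :=
  is_subshift G /\ exists2 F : set (seq Lam), finite_set F & is_basis G F.

Variable R : realType.

Definition shift_dist x y : R :=
  inf [set (2 ^- n : R) | n in [set n | forall i, (i < n)%N -> x i = y i]].

(* The chain is c 0, ..., c n; the values of c beyond n are irrelevant. *)
Definition is_chain (delta : R) (a b : shift_space) (n : nat)
    (c : nat -> shift_space) : Prop :=
  [/\ (1 <= n)%N, c 0%N = a, c n = b &
      forall i, (i < n)%N -> shift_dist (shift (c i)) (c i.+1) < delta].

Definition internally_chain_transitive A : Prop :=
  forall a b, A a -> A b -> forall delta : R, 0 < delta ->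
  exists n (c : nat -> shift_space),
    is_chain delta a b n c /\ forall i, (i <= n)%N -> A (c i).

End Shift.

(* Main.v *)
Require Import Defs.
From mathcomp Require Import all_boot all_order all_algebra.
From mathcomp Require Import all_classical all_reals topology.
From mathcomp Require Import zify.

Import Order.TTheory GRing.Theory Num.Theory.

(** Only finitely many symbols occur in a finite basis of forbidden words, so
    some symbol [s] occurs in none of them.  Inserting [s] between a prefix of
    [a] and the whole of [b] therefore creates no forbidden word: a basis word
    in [a_0 ... a_(m-1) s b] would already lie in [a] or in [b].  The orbit of
    this point of Gamma shadows [a] at its start and ends exactly at [b]. *)

Local Open Scope classical_set_scope.

Section ShiftSpace.
Variable Lam : choiceType.
Implicit Types (x y z : shift_space Lam) (G : set (shift_space Lam)).

Definition shiftn (n : nat) x : shift_space Lam := fun k => x (n + k)%N.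

Lemma subshift_shiftn G x n : is_subshift G -> G x -> G (shiftn n x).
Proof.
move=> [_ GE] Gx; elim: n => [|n IHn].
  by rewrite (_ : shiftn 0 x = x).
rewrite -GE; exists (shiftn n x) => //.
by apply/funext => k; rewrite /shift /shiftn addnS.
Qed.

(** The product topology is a supremum of coordinatewise topologies, so each coordinate can be
    treated alone, and coordinate [i] of [u n] is constant once [n > i]. *)
Lemma cvg_shift_space (u : nat -> shift_space Lam) z :
  (forall n k, (k < n)%N -> u n k = z k) -> u @ \oo --> z.
Proof.
move=> uz; apply/cvg_sup => i U [V [[W oW <-] Wz VU]].
exists i.+1 => // n /= ltin; apply: VU => /=.
by rewrite /preimage /= uz.
Qed.

Lemma closed_prefixes G z : closed G ->
  (forall n, exists2 x, G x & forall k, (k < n)%N -> x k = z k) -> G z.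
Proof.
move=> clG zG.
have /choice[u uP] n : exists v : shift_space Lam,
    G v /\ forall k, (k < n)%N -> v k = z k.
  by have [x Gx xz] := zG n; exists x.
have u_z : u @ \oo --> z by apply: cvg_shift_space => n k; apply: (uP n).2.
by apply: (closed_cvg G clG _ _ u_z); exists 0%N => // n _; exact: (uP n).1.
Qed.

Lemma occurs_inP (s : Lam) (w : seq Lam) x :
  occurs_in w x <->
  exists i, forall k, (k < size w)%N -> nth s w k = x (i + k)%N.
Proof.
split=> -[i wE]; exists i.
  by move=> k ltk; rewrite {1}wE nth_mkseq.
apply: (@eq_from_nth _ s); first by rewrite size_mkseq.
by move=> k ltk; rewrite nth_mkseq// wE.
Qed.

Lemma occurs_in_infix (u w : seq Lam) x :
  infix u w -> occurs_in w x -> occurs_in u x.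
Proof.
(* The empty word occurs everywhere; a nonempty one supplies the default letter [s] for [nth]. *)
case: u => [|s u]; first by exists 0%N.
move=> /infixP[p [q ->]] /(occurs_inP s)[i wE].
apply/(occurs_inP s); exists (i + size p)%N => k ltk.
rewrite -addnA -wE; last by rewrite !size_cat ltn_add2l ltn_addr.
by rewrite nth_cat ltnNge leq_addr addKn nth_cat ltk.
Qed.

(** A forbidden prefix of [z] would contain a word of [F], so all prefixes are allowed. Shifting a
    point of [G] in which a prefix occurs brings that prefix to the front, and closedness
    concludes. *)
Lemma basis_avoid_mem G (F : set (seq Lam)) z : is_subshift G -> is_basis G F ->
  (forall u, F u -> ~ occurs_in u z) -> G z.
Proof.
move=> subG [_ basF] zF; apply: closed_prefixes => [|n]; first by case: subG.
(* Length [n.+1] rather than [n], since words must be nonempty. *)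
have [[_ [x Gx [i]]]|naz] := pselect (allowed G (mkseq z n.+1)).
  rewrite size_mkseq => E; exists (shiftn i x); first exact: subshift_shiftn.
  move=> k ltk; have := congr1 (fun s => nth (z 0%N) s k) E.
  by rewrite !nth_mkseq ?(ltnW ltk)//; exact: leqW.
have [|u Fu uz] := basF (mkseq z n.+1); first by split; rewrite /is_word ?size_mkseq.
exfalso; apply: (zF _ Fu); apply: occurs_in_infix uz _.
by exists 0%N; rewrite size_mkseq.
Qed.

Definition splice (s : Lam) (m : nat) x y : shift_space Lam :=
  fun k => if (k < m)%N then x k else if k == m then s else y (k - m.+1)%N.

Lemma shiftn_splice s m x y : shiftn m.+1 (splice s m x y) = y.
Proof.
apply/funext => k; rewrite /shiftn /splice.
by rewrite ifF ?ifF ?addKn//; lia.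
Qed.

(** An occurrence covering position [m] would make [s] a letter of [w], so it lies entirely before
    or after [m]. *)
Lemma occurs_in_splice s m x y (w : seq Lam) : s \notin w ->
  occurs_in w (splice s m x y) -> occurs_in w x \/ occurs_in w y.
Proof.
move=> sw /(occurs_inP s)[i wE].
have [le_m|lt_m] := leqP (i + size w) m.
  left; apply/(occurs_inP s); exists i => k ltk.
  by rewrite wE// /splice ifT//; lia.
have [lt_mi|le_im] := ltnP m i.
  right; apply/(occurs_inP s); exists (i - m.+1)%N => k ltk.
  by rewrite wE// /splice ifF ?ifF; [congr y| |]; lia.
have ltm : (m - i < size w)%N by lia.
by have := mem_nth s ltm; rewrite wE// subnKC// /splice ltnn eqxx (negPf sw).
Qed.

Lemma finite_words_fresh (F : set (seq Lam)) :
  infinite_set [set: Lam] -> finite_set F ->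
  exists s : Lam, forall u, F u -> s \notin u.
Proof.
move=> infL finF; apply: contrapT => /forallNP noS; apply: infL.
apply: sub_finite_set (bigcup_finite finF (fun u _ => finite_seq u)) => s _.
have /existsNP[u /not_implyP[Fu /negP]] := noS s.
by rewrite negbK => su; exists u.
Qed.

Lemma splice_mem s G (F : set (seq Lam)) m x y :
  is_subshift G -> is_basis G F -> (forall u, F u -> s \notin u) ->
  G x -> G y -> G (splice s m x y).
Proof.
move=> subG basF sF Gx Gy; apply: (basis_avoid_mem _ _ _ subG basF) => u Fu uz.
have [wu nau] := basF.1 _ Fu; apply: nau; split=> //.
by case: (occurs_in_splice _ _ _ _ _ (sF _ Fu) uz); [exists x|exists y].
Qed.

Lemma shift_dist_le (R : realType) n x y :
  (forall i, (i < n)%N -> x i = y i) -> (shift_dist R x y <= 2 ^- n)%R.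
Proof.
move=> xy; apply: ge_inf; last by exists n.
by exists 0%R => _ [k _ <-]; rewrite invr_ge0 exprn_ge0.
Qed.

End ShiftSpace.

Lemma pow2V_lt (R : realType) (e : R) :
  (0 < e)%R -> exists n : nat, (2 ^- n < e)%R.
Proof.
(* With [n] this bound, [2 ^ n > n > e^-1]. *)
move=> e0; exists (Num.bound e^-1).
rewrite invf_plt ?posrE ?exprn_gt0//.
apply: (@lt_trans _ _ (Num.bound e^-1)%:R%R).
  by apply: archi_boundP; rewrite invr_ge0 ltW.
by rewrite -natrX ltr_nat ltn_expl.
Qed.

Theorem lemma18 (R : realType) (Lam : choiceType)
    (Lam_infinite : infinite_set [set: Lam])
    (Gamma : set (shift_space Lam)) (Gamma_subshift : is_subshift Gamma) :
  is_SFT Gamma -> internally_chain_transitive R Gamma.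
Proof.
move=> [_ [F finF basF]] a b Ga Gb delta delta0.
have [s sF] := finite_words_fresh _ _ Lam_infinite finF.
have [n ltn_delta] := pow2V_lt _ _ delta0.
(* The first step compares [shift a] with [shift z] on [n] places, so [z] must agree with [a] on
   [n.+1]. *)
pose z := splice _ s n.+1 a b.
have Gz : Gamma z by exact: splice_mem basF sF Ga Gb.
(* The orbit of [z] with its initial point replaced by [a]: only the first step has an error, and
   the shift by [n.+2] removes the prefix and [s], leaving [b]. *)
exists n.+2, (fun i => if i is 0 then a else shiftn _ i z); split; last first.
  by case=> [|i] _ //; exact: subshift_shiftn.
split=> //; first exact: shiftn_splice.
move=> i _; apply: le_lt_trans ltn_delta; apply: shift_dist_le => k ltk.
case: i => [|i]; last by rewrite /shift /shiftn addnS.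
by rewrite /shift /shiftn /z /splice add1n ltnS ltk.
Qed.
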